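(* Let $0<\mu\le L$, $\kappa=L/\mu$, and $f\in S_{\mu,L}(\mathbb{R}^d)$. Let $p\ge 1$ and let $n_1\ge 1$ be an integer. Run the algorithm M-ASG with $\alpha_1=\frac1L$, this $n_1$, and, for all $k\ge 2$, $$n_k=2^k\left\lceil \sqrt{\kappa}\,\log(2^{p+2})\right\rceil,\qquad \alpha_k=\frac{1}{2^{2k}L}.$$ Then for every $k\ge 1$ the last iterate $x^k_{n_k+1}$ of stage $k$ satisfies $$\mathbb{E}\big[f(x^k_{n_k+1})\big]-f^*\le \frac{2}{2^{(p+1)(k-1)}}\,\exp(-n_1/\sqrt{\kappa})\,\big(f(x_0^0)-f^*\big)+\frac{\sigma^2\sqrt{\kappa}}{L\,2^{k-1}}.$$
   Context: $S_{\mu,L}(\mathbb{R}^d)$ is the set of continuously differentiable $f:\mathbb{R}^d\to\mathbb{R}$ with $\frac{\mu}{2}\|x-y\|^2\le f(x)-f(y)-\nabla f(y)^\top(x-y)\le\frac L2\|x-y\|^2$ for all $x,y$. $x^*$ is the unique minimizer of $f$, $f^*=f(x^* )$; $\log$ is the natural logarithm. Stochastic oracle with noise level $\sigma\ge0$: each time the algorithm needs a gradient at a query point $z$ (a function of the initial point and of the randomness used in earlier queries), it receives $\tilde\nabla f(z,w)$, where the random variables $w$ used in the different queries are independent, so that $w$ is independent of all the past, and $\mathbb{E}[\tilde\nabla f(z,w)\mid z]=\nabla f(z)$, $\mathbb{E}[\|\tilde\nabla f(z,w)-\nabla f(z)\|^2\mid z]\le\sigma^2$. M-ASG (Multistage Accelerated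 Stochastic Gradient) with stage lengths $n_k\in\mathbb{N}$ and stepsizes $\alpha_k\in(0,1/L]$, from a deterministic initial point $x_0^0\in\mathbb{R}^d$: for stages $k=1,2,\dots$, let $\beta_k=\frac{1-\sqrt{\mu\alpha_k}}{1+\sqrt{\mu\alpha_k}}$; set $x_0^k=x_1^k=x_{n_{k-1}+1}^{k-1}$ (for $k=1$: $x_0^1=x_1^1=x_0^0$); and for $m=1,\dots,n_k$ set $y_m^k=(1+\beta_k)x_m^k-\beta_k x_{m-1}^k$ and $x_{m+1}^k=y_m^k-\alpha_k\tilde\nabla f(y_m^k,w_m^k)$. *)

(* Defs.v *)
From mathcomp Require Export all_boot all_order all_algebra finmap.
From mathcomp Require Export all_classical all_reals all_analysis.
Export Order.TTheory GRing.Theory Num.Theory.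
Export numFieldNormedType.Exports.

Set Implicit Arguments.
Unset Strict Implicit.
Unset Printing Implicit Defensive.

Local Open Scope classical_set_scope.
Local Open Scope ring_scope.

(* The library norm `|v| on 'rV[R]_d is the sup norm; the Euclidean inner
   product and norm are therefore defined here. Differentiability, continuity
   and open sets are the same for both norms. *)
Definition dotv (R : realType) (d : nat) (u v : 'rV[R]_d) : R :=
  \sum_(i < d) u 0 i * v 0 i.

Definition enorm (R : realType) (d : nat) (v : 'rV[R]_d) : R :=
  Num.sqrt (dotv v v).

Definition gradient (R : realType) (d : nat) (f : 'rV[R]_d -> R)
    (x : 'rV[R]_d) : 'rV[R]_d :=
  \row_(i < d) 'D_(delta_mx 0 i) f x.

Definition continuously_differentiable (R : realType) (d : nat)
    (f : 'rV[R]_d -> R) : Prop :=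
  (forall x, differentiable f x) /\ continuous (gradient f).

Definition S_class (R : realType) (d : nat) (mu L : R) : set ('rV[R]_d -> R) :=
  [set f | continuously_differentiable f /\
    forall x y : 'rV[R]_d,
      mu / 2 * enorm (x - y) ^+ 2 <= f x - f y - dotv (gradient f y) (x - y)
                                  <= L / 2 * enorm (x - y) ^+ 2].

Definition unique_minimizer (R : realType) (d : nat) (f : 'rV[R]_d -> R)
    (xs : 'rV[R]_d) : Prop :=
  forall y, y <> xs -> f xs < f y.

(* R^d with its Borel sigma-algebra; the carrier is 'rV[R]_d. *)
Notation borel_rV R d := (g_sigma_algebraType (@open 'rV[R]_d)).

Definition mutually_independent (dT : measure_display) (T : measurableType dT)
    (R : realType) (P : probability T R)
    (dW : measure_display) (W : measurableType dW)
    (I : choiceType) (D : set I) (w : I -> T -> W) : Prop :=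
  (forall i, D i -> measurable_fun setT (w i)) /\
  forall (J : {fset I}) (B : I -> set W),
    (forall i, i \in J -> D i) ->
    (forall i, i \in J -> measurable (B i)) ->
    P (\bigcap_(i in [set` J]) (w i @^-1` B i)) =
      (\prod_(i <- J) P (w i @^-1` B i))%E.

(* Y is a version of E[X | z], for a random variable z. *)
Definition is_cond_expectation (dT : measure_display) (T : measurableType dT)
    (R : realType) (P : probability T R)
    (dZ : measure_display) (Z : measurableType dZ) (z : T -> Z)
    (X Y : T -> R) : Prop :=
  [/\ P.-integrable setT (EFin \o X),
      P.-integrable setT (EFin \o Y),
      forall B : set R, measurable B ->
        g_sigma_algebra_preimage z (Y @^-1` B) &
      forall A : set T, g_sigma_algebra_preimage z A ->
        (\int[P]_(t in A) (X t)%:E = \int[P]_(t in A) (Y t)%:E)%E].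

(* The oracle answers the query z with g (z, w). *)
Definition oracle_query (dT : measure_display) (T : measurableType dT)
    (R : realType) (P : probability T R) (W : Type) (d : nat)
    (f : 'rV[R]_d -> R) (g : 'rV[R]_d -> W -> 'rV[R]_d) (sigma : R)
    (z : T -> 'rV[R]_d) (w : T -> W) : Prop :=
  (forall i : 'I_d,
     is_cond_expectation P (z : T -> borel_rV R d)
       (fun t => g (z t) (w t) 0 i) (fun t => gradient f (z t) 0 i)) /\
  exists V : T -> R,
    is_cond_expectation P (z : T -> borel_rV R d)
      (fun t => enorm (g (z t) (w t) - gradient f (z t)) ^+ 2) V /\
    {ae P, forall t, V t <= sigma ^+ 2}.

Definition momentum (R : realType) (mu a : R) : R :=
  (1 - Num.sqrt (mu * a)) / (1 + Num.sqrt (mu * a)).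

(* Stages are numbered from 1, queries in stage k from 1 to n k;
   n 0, alpha 0 and the values of w and y at other indices are never used. *)
Definition query_index (n : nat -> nat) : set (nat * nat) :=
  [set km | (1 <= km.1)%N /\ (1 <= km.2 <= n km.1)%N].

(* x k m, y k m and w k m stand for x_m^k, y_m^k and w_m^k. *)
Record is_masg (R : realType) (d : nat) (T W : Type) (mu : R)
    (n : nat -> nat) (alpha : nat -> R)
    (g : 'rV[R]_d -> W -> 'rV[R]_d) (w : nat * nat -> T -> W)
    (x00 : 'rV[R]_d) (x y : nat -> nat -> T -> 'rV[R]_d) : Prop := IsMASG {
  masg_init : forall t, x 1%N 1%N t = x00;
  masg_restart : forall k t, (1 <= k)%N -> x k.+1 1%N t = x k (n k).+1 t;
  masg_no_momentum : forall k t, (1 <= k)%N -> x k 0%N t = x k 1%N t;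
  masg_query : forall k m t, query_index n (k, m) ->
    y k m t = (1 + momentum mu (alpha k)) *: x k m t
              - momentum mu (alpha k) *: x k m.-1 t;
  masg_update : forall k m t, query_index n (k, m) ->
    x k m.+1 t = y k m t - alpha k *: g (y k m t) (w (k, m) t)
}.

(* Main.v *)
(* With s = sqrt (mu alpha), the Lyapunov function
   V_m = |(x_m - x^* ) - (1 - s) (x_(m-1) - x^* )|^2 / (2 alpha) + f x_m - f x^*
   satisfies, for every realization of the noise e in the gradient at y_m,
     V_(m+1) <= (1 - s) V_m + alpha (1 + alpha L) / 2 |e|^2 + <e, U>,
   where U depends only on y_m and x_m. The oracle hypothesis conditions on y_m
   alone while U also involves x_m; since w_m is independent of the past, Fubini
   gives E[g(z, w_m)] = grad f(z) for almost every value z of y_m, and hence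
   E<e, U> = 0. A stage starts with V <= 2 (f - f^* ), so it multiplies the
   expected gap by at most 2 (1 - s)^n and adds
   sigma^2 alpha (1 + alpha L) / (2 s); from the second stage on the factor is
   at most 2^-(p+1) <= 1/4 and the added term at most half of the target for the
   noise part. *)
Require Import Defs.
From mathcomp Require Import measurable_realfun ring lra.

Set Implicit Arguments.
Unset Strict Implicit.
Unset Printing Implicit Defensive.

Local Open Scope classical_set_scope.
Local Open Scope ring_scope.

(** * Smooth strongly convex functions *)

Lemma subrKl (V : zmodType) (x y : V) : x - y - x = - y.
Proof. by rewrite addrAC subrr add0r. Qed.

Section euclidean.
Context (R : realType) (d : nat).
Implicit Types u v w : 'rV[R]_d.

Lemma dotvC u v : dotv u v = dotv v u.
Proof. by apply: eq_bigr => i _; rewrite mulrC. Qed.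

Lemma dotvDl u v w : dotv (u + v) w = dotv u w + dotv v w.
Proof. by rewrite -big_split; apply: eq_bigr => i _; rewrite !mxE mulrDl. Qed.

Lemma dotvDr u v w : dotv w (u + v) = dotv w u + dotv w v.
Proof. by rewrite dotvC dotvDl !(dotvC w). Qed.

Lemma dotvZl c u v : dotv (c *: u) v = c * dotv u v.
Proof. by rewrite mulr_sumr; apply: eq_bigr => i _; rewrite !mxE mulrA. Qed.

Lemma dotvZr c u v : dotv u (c *: v) = c * dotv u v.
Proof. by rewrite dotvC dotvZl dotvC. Qed.

Lemma dotvNl u v : dotv (- u) v = - dotv u v.
Proof. by rewrite -scaleN1r dotvZl mulN1r. Qed.

Lemma dotvNr u v : dotv u (- v) = - dotv u v.
Proof. by rewrite dotvC dotvNl dotvC. Qed.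

Definition dotvE := (dotvDl, dotvDr, dotvNl, dotvNr, dotvZl, dotvZr).

Lemma dotv_ge0 u : 0 <= dotv u u.
Proof. by apply: sumr_ge0 => i _; rewrite -expr2 sqr_ge0. Qed.

Lemma dotv_eq0 u : (dotv u u == 0) = (u == 0).
Proof.
apply/idP/eqP => [|->]; last by rewrite /dotv big1// => i _; rewrite mxE mul0r.
rewrite psumr_eq0 => [/allP u0|i _]; last by rewrite -expr2 sqr_ge0.
apply/rowP => i; rewrite mxE; apply/eqP.
by have := u0 i (mem_index_enum i); rewrite mulf_eq0 orbb.
Qed.

Lemma sqr_enorm u : enorm u ^+ 2 = dotv u u.
Proof. by rewrite sqr_sqrtr// dotv_ge0. Qed.

Lemma le_dotvD u v : dotv (u + v) (u + v) <= 2 * dotv u u + 2 * dotv v v.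
Proof.
have := dotv_ge0 (u - v); rewrite !dotvE (dotvC v u); lra.
Qed.

End euclidean.

Section smooth_strongly_convex.
Context (R : realType) (d : nat) (mu L : R) (f : 'rV[R]_d -> R).
Hypotheses (mu_gt0 : 0 < mu) (mu_leL : mu <= L) (fS : S_class mu L f).

Let L_gt0 : 0 < L. Proof. exact: lt_le_trans mu_leL. Qed.

Lemma S_class_lower x y :
  f y + dotv (gradient f y) (x - y) + mu / 2 * dotv (x - y) (x - y) <= f x.
Proof. have [_ /(_ x y)/andP[]] := fS; rewrite sqr_enorm; lra. Qed.

Lemma S_class_upper x y :
  f x <= f y + dotv (gradient f y) (x - y) + L / 2 * dotv (x - y) (x - y).
Proof. have [_ /(_ x y)/andP[]] := fS; rewrite sqr_enorm; lra. Qed.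

(** * Bounds around the minimizer and the Lyapunov step *)

Section minimizer.
Variable xs : 'rV[R]_d.
Hypothesis xs_min : unique_minimizer f xs.

Lemma minimizer_le y : f xs <= f y.
Proof. by have [->//|/eqP yxs] := eqVneq y xs; exact/ltW/xs_min. Qed.

(** A gradient step of length [L^-1] from [y] lowers [f] by at least |gradient|^2 / (2 L), and it
    cannot go below the minimum. *)
Lemma sqr_gradient_le y :
  dotv (gradient f y) (gradient f y) <= 2 * L * (f y - f xs).
Proof.
have := S_class_upper (y - L^-1 *: gradient f y) y.
have := minimizer_le (y - L^-1 *: gradient f y).
rewrite subrKl !dotvE.
set q := dotv _ _ => m1 m2.
have : f xs <= f y - L^-1 * q / 2.
  apply: le_trans m1 (le_trans m2 _); rewrite le_eqVlt; apply/orP; left.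
  by apply/eqP; field; rewrite gt_eqF.
move=> h; have : L^-1 * q <= 2 * (f y - f xs) by lra.
by rewrite -(ler_pM2l L_gt0) mulrA divff ?gt_eqF// mul1r mulrCA mulrA.
Qed.

Lemma gradient_minimizer : gradient f xs = 0.
Proof.
apply/eqP; rewrite -dotv_eq0 eq_le dotv_ge0 andbT.
by have := sqr_gradient_le xs; rewrite subrr mulr0.
Qed.

Lemma quadratic_growth y : mu / 2 * dotv (y - xs) (y - xs) <= f y - f xs.
Proof.
(* The zero gradient is written [0 *: 0], so that [dotvZl] removes the linear term. *)
by have := S_class_lower y xs; rewrite gradient_minimizer -(scale0r 0) dotvZl; lra.
Qed.

Lemma quadratic_upper y : f y - f xs <= L / 2 * dotv (y - xs) (y - xs).
Proof.
by have := S_class_upper y xs; rewrite gradient_minimizer -(scale0r 0) dotvZl; lra.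
Qed.

(* With [s = sqrt (mu * a)] this is [mu / 2 * |c - xs|^2 + f u - f xs] for
   [c = (u - (1 - s) v) / s], the estimating point of Nesterov's method. *)
Definition lyapunov (a : R) (u v : 'rV[R]_d) : R :=
  let z := (u - xs) - (1 - Num.sqrt (mu * a)) *: (v - xs) in
  dotv z z / (2 * a) + (f u - f xs).

Lemma lyapunov_ge a u v : 0 < a -> f u - f xs <= lyapunov a u v.
Proof.
move=> a_gt0; rewrite /lyapunov lerDr mulr_ge0 ?dotv_ge0// invr_ge0.
by rewrite mulr_ge0// ltW.
Qed.

(** For equal arguments the vector inside collapses to [s *: (u - xs)]; as [s ^+ 2 = mu * a], its
    term is [mu / 2] times the squared distance, which quadratic growth bounds by the gap. *)
Lemma lyapunov_diag_le a u : 0 < a -> lyapunov a u u <= 2 * (f u - f xs).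
Proof.
move=> a_gt0; have := quadratic_growth u.
rewrite /lyapunov (_ : _ - _ *: _ = Num.sqrt (mu * a) *: (u - xs)); last first.
  by apply/rowP => i; rewrite !mxE; ring.
rewrite dotvZl dotvZr; move: (dotv _ _) => q mq.
have s2 : Num.sqrt (mu * a) ^+ 2 = mu * a by rewrite sqr_sqrtr// mulr_ge0 ?ltW.
rewrite (_ : _ / (2 * a) = mu / 2 * q); first by lra.
rewrite mulrA -expr2 s2; field.
by rewrite gt_eqF.
Qed.

(* The term linear in [e] is kept, since it only vanishes in expectation. *)
Lemma lyapunov_step a (x x' y e : 'rV[R]_d) (s := Num.sqrt (mu * a)) :
  0 < a -> a * L <= 1 ->
  y = (1 + momentum mu a) *: x - momentum mu a *: x' ->
  lyapunov a (y - a *: (gradient f y + e)) x <=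
    (1 - s) * lyapunov a x x' + a * (1 + a * L) / 2 * dotv e e
    + dotv e (L * a ^+ 2 *: gradient f y - s *: (y - xs) - (1 - s) *: (y - x)).
Proof.
move=> a_gt0 aL yE.
have s_ge0 : 0 <= s by exact: sqrtr_ge0.
have s2 : s ^+ 2 = mu * a by rewrite sqr_sqrtr// mulr_ge0 ?ltW.
have s_le1 : s <= 1.
  rewrite -(@ler_sqr _ s 1) ?nnegrE// s2 expr1n (le_trans _ aL)//.
  by rewrite mulrC ler_pM2l.
pose A := y - xs; pose B := y - x.
(* The momentum satisfies (1 + s) * momentum = 1 - s, which is exactly what eliminates [x'] in
   favour of [y]. *)
have zE : (x - xs) - (1 - s) *: (x' - xs) = s *: A + B.
  apply/rowP => i; rewrite /A /B {A B} yE !mxE /momentum -/s.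
  by field; rewrite gt_eqF// ltr_pwDl.
have zE' : (y - a *: (gradient f y + e) - xs) - (1 - s) *: (x - xs) =
    s *: A + (1 - s) *: B - a *: (gradient f y + e).
  by apply/rowP => i; rewrite !mxE; ring.
rewrite /lyapunov -/s zE zE'.
have := S_class_upper (y - a *: (gradient f y + e)) y.
have := S_class_lower xs y; have := S_class_lower x y.
rewrite -/A -/B -[xs - y]opprB -[x - y]opprB subrKl -/A -/B.
clearbody A B; have := dotv_ge0 B; have := dotv_ge0 (gradient f y).
move: (gradient f y) => G; rewrite !dotvE.
rewrite (dotvC G e) (dotvC B A) (dotvC A G) (dotvC A e) (dotvC B G) (dotvC B e).
move: (dotv A A) (dotv A B) (dotv B B) (dotv G G) (dotv e e) (dotv G A)
  (dotv e A) (dotv G B) (dotv e B) (dotv e G) => AA AB BB GG EE GA EA GB EB GE.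
move: (f (y - _)) (f y) (f x) (f xs) => fn fy fx fs.
move=> GG0 BB0 Hx Hs Hn.
(* Substituting this makes the final identity rational in [s] and [a]. *)
have muE : mu = s ^+ 2 / a by rewrite s2 mulfK// gt_eqF.
(* The claimed difference is the sum of [h1] to [h6]: strong convexity at [xs] and at [x] with
   weights [s] and [1 - s], smoothness at the new point with weight 1, and leftover multiples of
   |G|^2 and |B|^2, nonnegative since [a * L <= 1] and [s <= 1]. *)
have h1 : 0 <= s * (fs - fy + GA - mu / 2 * AA) by rewrite mulr_ge0//; lra.
have h2 : 0 <= (1 - s) * (fx - fy + GB - mu / 2 * BB) by rewrite mulr_ge0//; lra.
have h3 : 0 <= a / 2 * (1 - a * L) * GG by rewrite !mulr_ge0//; lra.
have h4 : 0 <= (1 - s) * (mu / 2) * BB.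
  by rewrite mulr_ge0 ?mulr_ge0 ?subr_ge0 ?invr_ge0// ltW.
have h5 : 0 <= s * (1 - s) / (2 * a) * BB.
  by rewrite mulr_ge0// divr_ge0 ?mulr_ge0//; lra.
have h6 : 0 <= fy - a * (GG + GE) + L / 2 * a ^+ 2 * (GG + 2 * GE + EE) - fn by lra.
rewrite -subr_ge0.
have := addr_ge0 (addr_ge0 (addr_ge0 (addr_ge0 (addr_ge0 h1 h2) h3) h4) h5) h6.
congr (0 <= _); rewrite muE; field.
by rewrite gt_eqF.
Qed.

End minimizer.
End smooth_strongly_convex.

(** * Borel sets of row vectors *)

Section borel_rV.
Context (R : realType) (d : nat).

Lemma continuous_borel_rV (h : 'rV[R]_d -> R) :
  continuous h -> measurable_fun setT (h : borel_rV R d -> R).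
Proof.
move=> /continuousP ch; apply: (measurability _ (RGenOpens.measurableE R)).
move=> _ [_ [a [b ->]] <-]; rewrite setTI; apply: sub_sigma_algebra.
by apply: ch; exact: interval_open.
Qed.

Lemma measurable_coord (i : 'I_d) :
  measurable_fun setT ((fun v => v 0 i) : borel_rV R d -> R).
Proof. by apply: continuous_borel_rV => v; exact: coord_continuous. Qed.

(** Rational balls form a countable base. Balls not contained in [U] are replaced by [set0], so that
    the index type itself is countable. *)
Lemma open_rV_bigcup_ball (U : set 'rV[R]_d) : open U ->
  U = \bigcup_(q : 'rV[rat]_d * rat)
        (if `[<ball (map_mx ratr q.1 : 'rV[R]_d) (ratr q.2) `<=` U>]
         then ball (map_mx ratr q.1 : 'rV[R]_d) (ratr q.2) else set0).
Proof.
move=> oU; apply/seteqP; split=> [v Uv|v [q _]]; last first.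
  by case: asboolP => // qU /qU.
have /nbhs_ballP[e /= e0 eU] : nbhs v U by exact: open_nbhs_nbhs.
(* With a radius below [e / 2], a ball that contains [v] stays within distance [e] of [v]. *)
have e20 : 0 < e / 2 by rewrite divr_gt0.
have [r /[!in_itv]/= /andP[r0 re]] := rat_in_itvoo e20.
have qP i : exists q : rat, `|v 0 i - ratr q| < ratr r.
  have /rat_in_itvoo[q /[!in_itv]/= /andP[vq qv]] :
    v 0 i - ratr r < v 0 i + ratr r by lra.
  by exists q; rewrite ltr_distlC; apply/andP; split; lra.
pose q := \row_i sval (cid (qP i)).
have vq : ball (map_mx ratr q : 'rV[R]_d) (ratr r) v.
  split=> // i j; rewrite (ord1 i) !mxE/= /ball/= distrC.
  exact: svalP (cid (qP j)).
exists (q, r) => //=; case: asboolP => // -[]; apply: subset_trans eU.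
move=> u qu; rewrite [e]splitr; apply: ball_triangle (ball_sym _) _.
- by apply: le_ball vq; exact: ltW.
- by apply: le_ball qu; exact: ltW.
Qed.

(** Balls of the sup norm are boxes, so the preimage of a ball is a finite intersection of
    coordinate preimages. *)
Lemma measurable_to_borel_rV d' (T : measurableType d') (h : T -> 'rV[R]_d) :
  (forall i, measurable_fun setT (fun t => h t 0 i)) ->
  measurable_fun setT (h : T -> borel_rV R d).
Proof.
move=> mh; apply: (@measurability _ _ T (borel_rV R d) setT h (@open _) erefl) => _ [U oU <-].
rewrite setTI (open_rV_bigcup_ball oU) preimage_bigcup.
apply: countable_bigcupT_measurable => [|[q r] /=]; first exact: countableP.
case: asboolP => _; last by rewrite preimage_set0.
(* A ball of nonpositive radius is empty, whereas for [d = 0] the intersection over coordinates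
   would be everything. *)
have [r0|r0] := leP (ratr r : R) 0.
  rewrite (_ : _ @^-1` _ = set0)//; apply/seteqP; split=> // t [].
  by rewrite ltNge r0.
rewrite (_ : _ @^-1` _ =
    \bigcap_(i in [set: 'I_d]) ((fun t => h t 0 i) @^-1` ball (ratr (q 0 i) : R) (ratr r))).
  apply: fin_bigcap_measurable => [|i _]; first exact: finite_finset.
  by rewrite -[X in measurable X]setTI; apply: mh => //; exact: measurable_ball.
apply/seteqP; split=> [t [_ ht] i _|t ht].
  by have := ht 0 i; rewrite mxE.
by split=> // i j; rewrite (ord1 i) mxE; exact: ht.
Qed.

End borel_rV.

(** * Independence *)

Section independence.
Context (dT : measure_display) (T : measurableType dT) (R : realType)
  (P : probability T R).

Section past.
Context (dW : measure_display) (W : measurableType dW) (I : choiceType)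
  (D : set I) (w : I -> T -> W).

(** These sets form the pi-system that generates the sigma-algebra of the variables [w i] with [i]
    in [K]. *)
Definition cylinder (K : set I) : set (set T) :=
  [set A | exists (J : {fset I}) (B : I -> set W),
    [/\ [set` J] `<=` K, (forall i, i \in J -> measurable (B i)) &
        A = \bigcap_(i in [set` J]) w i @^-1` B i]].

Lemma cylinder_setI_closed K : setI_closed (cylinder K).
Proof.
move=> _ _ [J1 [B1 [J1K mB1 ->]]] [J2 [B2 [J2K mB2 ->]]].
(* Padding with the full space makes both families constrain the union of the two index sets. *)
pose Bn (J : {fset I}) (B : I -> set W) i := if i \in J then B i else setT.
exists (J1 `|` J2)%fset, (fun i => Bn J1 B1 i `&` Bn J2 B2 i); split.
- by move=> i /=; rewrite in_fsetU => /orP[/J1K|/J2K].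
- by move=> i _; apply: measurableI; rewrite /Bn; case: ifPn => // ?;
    [exact: mB1|exact: mB2].
- apply/seteqP; split=> [t [t1 t2] i _ /=|t t12].
    by rewrite /Bn; split; case: ifPn => // iJ; [exact: t1|exact: t2].
  split=> i /= iJ; have := t12 i; rewrite /= in_fsetU iJ ?orbT => /(_ isT).
    by rewrite /Bn iJ => -[].
  by rewrite /Bn iJ => -[].
Qed.

Hypothesis indep : mutually_independent P D w.

Lemma cylinder_measurable K : K `<=` D -> cylinder K `<=` measurable.
Proof.
move=> KD _ [J [B [JK mB ->]]]; apply: fin_bigcap_measurable => [|i iJ].
  exact: finite_fset.
rewrite -[X in measurable X]setTI; apply: (indep.1 _ _ measurableT).
  exact/KD/JK.
exact: mB.
Qed.

(** With [C] the event on [w i0], the finite measures P(A and C) and P(C) P(A) agree on cylinders by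
    mutual independence, hence on the generated sigma-algebra. *)
Lemma past_independent K i0 : K `<=` D -> D i0 -> ~ K i0 ->
  forall A (B : set W), <<s cylinder K >> A -> measurable B ->
  P (A `&` w i0 @^-1` B) = (P A * P (w i0 @^-1` B))%E.
Proof.
move=> KD Di0 Ki0 A B KA mB.
have mC : measurable (w i0 @^-1` B).
  by rewrite -[X in measurable X]setTI; exact: (indep.1 _ Di0 measurableT).
set C := w i0 @^-1` B.
have pC : 0 <= fine (P C) by rewrite fine_ge0.
have PCE : (fine (P C))%:E = P C by rewrite fineK// fin_num_measure.
pose m1 : {measure set T -> \bar R} := mrestr P mC.
pose m2 : {measure set T -> \bar R} := mscale (NngNum pC) P.
suff -> : P (A `&` C) = m2 A by rewrite /m2/= /mscale/= PCE muleC.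
apply: (@g_sigma_algebra_measure_unique _ R T (cylinder K) _ (fun=> setT) _ _ m1 m2).
- exact: cylinder_measurable.
- move=> _; exists fset0, (fun=> setT); split=> //.
  by apply/seteqP; split=> // t _ i.
- by rewrite bigcup_const//; exists 0%N.
- exact: cylinder_setI_closed.
- move=> _ [J [F [JK mF ->]]].
  rewrite /m1 /m2 /= /mrestr /mscale/= PCE.
  (* Since [i0] is not in [J], the event on [w i0] can be absorbed as one more factor of the
     cylinder. *)
  pose F' i := if i == i0 then B else F i.
  have i0J : i0 \notin J by apply/negP => /JK.
  have JF' : \bigcap_(i in [set` J]) w i @^-1` F i =
             \bigcap_(i in [set` J]) w i @^-1` F' i.
    apply: eq_bigcapr => i iJ; rewrite /F' ifN//.
    by apply: contraNneq i0J => <-.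
  have -> : \bigcap_(i in [set` J]) w i @^-1` F i `&` C =
            \bigcap_(i in [set` (i0 |` J)%fset]) w i @^-1` F' i.
    rewrite JF'; apply/seteqP; split=> [t [tJ tC] i /=|t tJ].
      by rewrite in_fset1U /F'; case: eqP => [->//|/eqP ii0 /=] /tJ; rewrite /F' (negbTE ii0).
    split=> [i /= iJ|]; first by apply: tJ; rewrite /= in_fset1U iJ orbT.
    by have := tJ i0; rewrite /= in_fset1U eqxx /F' eqxx; exact.
  rewrite indep.2.
  + rewrite big_fsetU1//= /F' eqxx JF' indep.2//.
    * by move=> i /JK/KD.
    * by move=> i iJ; rewrite /F'; case: ifPn => // _; exact: mF.
  + by move=> i; rewrite in_fset1U => /predU1P[->//|/JK/KD].
  + move=> i; rewrite in_fset1U /F'; case: ifPn => //= _; exact: mF.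
- by move=> _; rewrite /m1 /= /mrestr setTI ltey_eq fin_num_measure.
- exact: KA.
Qed.

End past.

Definition independent_of (dX : measure_display) (X : measurableType dX)
    (dY : measure_display) (Y : measurableType dY) (x : T -> X) (y : T -> Y) :=
  forall A B, measurable A -> measurable B ->
    P (x @^-1` A `&` y @^-1` B) = (P (x @^-1` A) * P (y @^-1` B))%E.

(** * The law of an independent pair *)

Section joint_law.
Context (dX : measure_display) (X : measurableType dX)
    (dY : measure_display) (Y : measurableType dY).
Variables (x : {mfun T >-> X}) (y : {mfun T >-> Y}) (h : X * Y -> \bar R).
Hypotheses (xy : independent_of x y) (mh : measurable_fun setT h)
  (ih : P.-integrable setT (fun t => h (x t, y t))).

Let mxy : measurable_fun setT (fun t => (x t, y t)).
Proof. exact: measurable_fun_pair. Qed.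

Let joint : {mfun T >-> (X * Y)%type} := mfun_Sub (mem_set mxy).

(** Independence gives equality on rectangles, which determines the product measure. *)
Let jointE A : measurable A ->
  distribution P joint A = (distribution P x \x distribution P y)%E A.
Proof.
by move=> mA; apply/esym/product_measure_unique.
Qed.

Lemma integrable_joint_law :
  (distribution P x \x distribution P y)%E.-integrable setT h.
Proof.
have /integrableP[_ hoo] : (distribution P joint).-integrable setT h.
  exact: integrable_pushforward.
apply/integrableP; split=> //.
by rewrite (eq_measure_integral (distribution P joint))// => A mA _; exact/esym/jointE.
Qed.

Lemma integral_joint_law :
  (\int[P]_t h (x t, y t) = \int[distribution P x]_a \int[distribution P y]_b h (a, b))%E.
Proof.
rewrite (integral12_prod_meas1 integrable_joint_law).
rewrite (eq_measure_integral (distribution P joint)) => [|A mA _]; last exact/esym/jointE.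
by rewrite integral_distribution.
Qed.

End joint_law.


(** * Products with a conditionally centred variable *)

Section mean_zero.
Context (dZ : measure_display) (Z : measurableType dZ)
    (dW : measure_display) (W : measurableType dW).
Variables (z : T -> Z) (u : T -> R) (w : T -> W) (h : Z * W -> R).
Hypotheses (mz : measurable_fun setT z) (mu : measurable_fun setT u)
  (mw : measurable_fun setT w) (mh : measurable_fun setT h).
Hypothesis zu_w : independent_of (fun t => (z t, u t)) w.
Hypothesis ih : P.-integrable setT (fun t => (h (z t, w t))%:E).
Hypothesis h0 : forall B, measurable B ->
  (\int[P]_(t in z @^-1` B) (h (z t, w t))%:E = 0)%E.

Let z' : {mfun T >-> Z} := mfun_Sub (mem_set mz).
Let w' : {mfun T >-> W} := mfun_Sub (mem_set mw).

Let zw : independent_of z' w'.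
Proof.
move=> A B mA mB; have := zu_w (measurableX mA measurableT) mB.
by rewrite /preimage/= (_ : [set t | _] = [set t | A (z t)])//; apply/seteqP; split=> t // [].
Qed.

(** By Fubini, [h0] says that the average of [h (a, _)] over the law of [w] integrates to 0 over
    every measurable set of values [a]; such a function vanishes almost everywhere. *)
Lemma mean_zero_ae :
  {ae distribution P z', forall a, (\int[distribution P w']_b (h (a, b))%:E = 0)%E}.
Proof.
have mh' : measurable_fun setT (EFin \o h) by exact/measurable_EFinP.
have ih' := integrable_joint_law zw mh' ih.
have := @integral_ae_eq _ _ _ (distribution P z') _ measurableT (cst 0%E) _
  (integrable_fubini_F ih') (measurable_cst _).
have hB E : E `<=` setT -> measurable E ->
    (\int[distribution P z']_(a in E) fubini_F (distribution P w') (EFin \o h) a =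
     \int[distribution P z']_(a in E) cst 0 a)%E.
  move=> _ mE; rewrite integral0 -[RHS](h0 mE) [LHS]integral_mkcond [RHS]integral_mkcond.
  (* The indicator of [E] is moved into the integrand, because the joint-law formula integrates over
     the whole space. *)
  pose hE ab := ((\1_E ab.1 * h ab)%:E).
  have mhE : measurable_fun setT hE.
    apply/measurable_EFinP/measurable_funM => //.
    apply: (measurableT_comp (f := \1_E : Z -> R)) => //.
  have -> : (fun t => (h (z t, w t))%:E) \_ (z @^-1` E) = (fun t => hE (z' t, w' t)).
    apply/funext => t; rewrite /hE patchE /= indicE.
    rewrite (_ : (t \in z @^-1` E) = (z t \in E)); last by apply/idP/idP; rewrite !inE.
    by case: ifP; rewrite (mul1r, mul0r).
  rewrite integral_joint_law//; last first.
    apply: le_integrable ih => //.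
      by apply: measurableT_comp mhE _; exact: measurable_fun_pair.
    move=> t _; rewrite lee_fin normrM ler_piMl// indicE.
    by case: (_ \in _); rewrite ?normr1 ?normr0.
  apply: eq_integral => a _; rewrite patchE /hE /fubini_F/= indicE.
  case: ifP => _; first by under [RHS]eq_integral do rewrite mul1r.
  by under [RHS]eq_integral do rewrite mul0r; rewrite integral0.
by move=> /(_ hB); apply: filterS => a /(_ I).
Qed.

(** The factor [u] need not be a function of [z]. For a fixed value (a, c) of (z, u), integrating
    over the law of [w] gives c times the average of [h (a, _)], which is 0 for almost every [a]. *)
Lemma integral_mean_zero_mul :
  P.-integrable setT (fun t => (u t * h (z t, w t))%:E) ->
  (\int[P]_t (u t * h (z t, w t))%:E = 0)%E.
Proof.
move=> iuh.
have mzu : measurable_fun setT (fun t => (z t, u t)) by exact: measurable_fun_pair.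
pose zu : {mfun T >-> (Z * R)%type} := mfun_Sub (mem_set mzu).
have zuw : independent_of zu w' by exact: zu_w.
have mh1 : measurable_fun setT (fun q : (Z * R) * W => (h (q.1.1, q.2))%:E).
  apply/measurable_EFinP; apply: measurableT_comp mh _.
  apply: measurable_fun_pair; last exact: measurable_snd.
  exact: measurableT_comp measurable_fst measurable_fst.
have muh : measurable_fun setT (fun q : (Z * R) * W => (q.1.2 * h (q.1.1, q.2))%:E).
  apply/measurable_EFinP/measurable_funM.
    exact: measurableT_comp measurable_snd measurable_fst.
  exact/measurable_EFinP.
have ih1 := integrable_joint_law zuw mh1 ih.
rewrite (integral_joint_law zuw muh iuh).
rewrite (_ : 0%E = \int[distribution P zu]_a cst 0%E a)%E; last by rewrite integral0.
apply: ae_eq_integral => //.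
  exact: (measurable_fubini_F (integrable_joint_law zuw muh iuh)).
have [N [mN PN hN]] := mean_zero_ae.
have h00 : {ae distribution P zu, forall a,
    (\int[distribution P w']_b (h (a.1, b))%:E = 0)%E}.
  (* The law of [z] is the first marginal of the law of [(z, u)], so a null set of values of [z]
     lifts to a null set of pairs. *)
  exists (fst @^-1` N); split=> //.
  - by rewrite -[X in measurable X]setTI; exact: measurable_fst.
  - by move=> a /= /hN.
move: h00 (ae_integrable1 ih1); apply: filterS2 => -[a c] /= h00 iac _.
under eq_integral do rewrite EFinM.
by rewrite integralZl// h00 mule0.
Qed.

End mean_zero.

End independence.

(** * Square-integrable vectors and the oracle *)

Section measurable_vectors.
Context (dT : measure_display) (T : measurableType dT) (R : realType) (d : nat).
Implicit Types X Y : T -> 'rV[R]_d.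

Definition measurable_rV X := measurable_fun setT (X : T -> borel_rV R d).

Lemma measurable_rV_coord X i :
  measurable_rV X -> measurable_fun setT (fun t => X t 0 i).
Proof. by move=> mX; exact: measurableT_comp (measurable_coord i) mX. Qed.

Lemma measurable_rV_cst (v : 'rV[R]_d) : measurable_rV (fun=> v).
Proof. exact: measurable_cst. Qed.

Lemma measurable_rVD X Y :
  measurable_rV X -> measurable_rV Y -> measurable_rV (fun t => X t + Y t).
Proof.
move=> mX mY; apply: measurable_to_borel_rV => i; under eq_fun do rewrite mxE.
by apply: measurable_funD; exact: measurable_rV_coord.
Qed.

Lemma measurable_rVZ c X : measurable_rV X -> measurable_rV (fun t => c *: X t).
Proof.
move=> mX; apply: measurable_to_borel_rV => i; under eq_fun do rewrite mxE.
by apply: measurable_funM => //; exact: measurable_rV_coord.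
Qed.

Lemma measurable_rVB X Y :
  measurable_rV X -> measurable_rV Y -> measurable_rV (fun t => X t - Y t).
Proof.
move=> mX mY; under eq_fun do rewrite -scaleN1r.
by apply: measurable_rVD => //; exact: measurable_rVZ.
Qed.

Lemma measurable_dotv X Y : measurable_rV X -> measurable_rV Y ->
  measurable_fun setT (fun t => dotv (X t) (Y t)).
Proof.
move=> mX mY; apply: measurable_sum => i.
by apply: measurable_funM; exact: measurable_rV_coord.
Qed.

Lemma measurable_rV_comp (F : 'rV[R]_d -> 'rV[R]_d) X :
  continuous F -> measurable_rV X -> measurable_rV (F \o X).
Proof.
move=> cF mX; apply: measurable_to_borel_rV => i.
apply: (measurableT_comp (f := (fun v => F v 0 i) : borel_rV R d -> R)) mX.
apply: continuous_borel_rV => v.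
by apply: (@continuous_comp _ _ _ F (fun v => v 0 i)); [exact: cF|exact: coord_continuous].
Qed.

End measurable_vectors.

Section square_integrable.
Context (dT : measure_display) (T : measurableType dT) (R : realType)
  (P : probability T R) (d : nat).
Implicit Types X Y : T -> 'rV[R]_d.

Definition sq_integrable X :=
  measurable_rV X /\ P.-integrable setT (fun t => (dotv (X t) (X t))%:E).

Lemma sq_integrable_le X (b : T -> R) : measurable_rV X ->
  P.-integrable setT (EFin \o b) -> (forall t, dotv (X t) (X t) <= b t) ->
  sq_integrable X.
Proof.
move=> mX ib Xb; split=> //; apply: le_integrable ib => //.
  by apply/measurable_EFinP; exact: measurable_dotv.
move=> t _ /=; rewrite lee_fin ger0_norm ?dotv_ge0//.
exact: le_trans (Xb t) (ler_norm _).
Qed.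

Lemma integrableZ_EFin c (b : T -> R) : P.-integrable setT (EFin \o b) ->
  P.-integrable setT (EFin \o (fun t => c * b t)).
Proof. by move=> ib; exact: (integrableZl measurableT c ib). Qed.

Lemma integrableD_EFin (b c : T -> R) : P.-integrable setT (EFin \o b) ->
  P.-integrable setT (EFin \o c) -> P.-integrable setT (EFin \o (fun t => b t + c t)).
Proof. by move=> ib ic; exact: (integrableD measurableT ib ic). Qed.

Lemma sq_integrable_cst v : sq_integrable (fun=> v).
Proof.
split; first exact: measurable_rV_cst.
exact: finite_measure_integrable_cst.
Qed.

Lemma sq_integrableZ c X : sq_integrable X -> sq_integrable (fun t => c *: X t).
Proof.
move=> [mX iX]; apply: sq_integrable_le (integrableZ_EFin (c ^+ 2) iX) _.
  exact: measurable_rVZ.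
by move=> t; rewrite dotvZl dotvZr mulrA -expr2.
Qed.

Lemma sq_integrableD X Y :
  sq_integrable X -> sq_integrable Y -> sq_integrable (fun t => X t + Y t).
Proof.
move=> [mX iX] [mY iY]; apply: sq_integrable_le (integrableD_EFin
  (integrableZ_EFin 2 iX) (integrableZ_EFin 2 iY)) _.
  exact: measurable_rVD.
by move=> t; exact: le_dotvD.
Qed.

Lemma sq_integrableB X Y :
  sq_integrable X -> sq_integrable Y -> sq_integrable (fun t => X t - Y t).
Proof.
move=> sX sY; under eq_fun do rewrite -scaleN1r.
by apply: sq_integrableD => //; exact: sq_integrableZ.
Qed.

(** From |a b| <= a^2 + b^2, each squared coordinate being at most the squared norm. *)
Lemma integrable_coordM X Y i : sq_integrable X -> sq_integrable Y ->
  P.-integrable setT (fun t => (X t 0 i * Y t 0 i)%:E).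
Proof.
move=> [mX iX] [mY iY]; apply: le_integrable (integrableD_EFin iX iY) => //.
  by apply/measurable_EFinP/measurable_funM; exact: measurable_rV_coord.
have sq (v : 'rV[R]_d) : v 0 i ^+ 2 <= dotv v v.
  rewrite /dotv (bigD1 i)//= -expr2 lerDl.
  by apply: sumr_ge0 => j _; rewrite -expr2 sqr_ge0.
move=> t _ /=; rewrite lee_fin (le_trans _ (ler_norm _))//.
apply: le_trans (lerD (sq (X t)) (sq (Y t))).
rewrite normrM -(real_normK (num_real (X t 0 i))) -(real_normK (num_real (Y t 0 i))).
have := normr_ge0 (X t 0 i); have := normr_ge0 (Y t 0 i); nra.
Qed.

Lemma integrable_dotv X Y : sq_integrable X -> sq_integrable Y ->
  P.-integrable setT (EFin \o (fun t => dotv (X t) (Y t))).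
Proof.
move=> sX sY; rewrite (_ : _ \o _ = fun t => (\sum_i (X t 0 i * Y t 0 i)%:E)%E).
  by apply: integrable_sum => // i _; exact: integrable_coordM.
by apply/funext => t; rewrite /= sumEFin.
Qed.

End square_integrable.

(** * Moments of the oracle error *)

Section oracle.
Context (dT : measure_display) (T : measurableType dT) (R : realType)
  (P : probability T R) (dW : measure_display) (W : measurableType dW) (d : nat).
Variables (mu L : R) (f : 'rV[R]_d -> R) (xs : 'rV[R]_d) (sigma : R)
  (g : 'rV[R]_d -> W -> 'rV[R]_d).
Hypotheses (mu_gt0 : 0 < mu) (mu_leL : mu <= L) (fS : S_class mu L f)
  (xs_min : unique_minimizer f xs)
  (mg : measurable_fun setT (fun zv : borel_rV R d * W => g zv.1 zv.2 : borel_rV R d)).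

Let cG : continuous (gradient f). Proof. by case: fS => -[]. Qed.

Let cf : continuous f.
Proof. by move=> v; apply: differentiable_continuous; case: fS => -[]. Qed.

Lemma measurable_oracle dV (V : measurableType dV) (z : V -> 'rV[R]_d) (w : V -> W) :
  measurable_rV z -> measurable_fun setT w -> measurable_rV (fun t => g (z t) (w t)).
Proof.
move=> mz mw.
exact: (measurableT_comp mg (measurable_fun_pair (mz : measurable_fun _ (z : V -> borel_rV R d)) mw)).
Qed.

Lemma measurable_objective dV (V : measurableType dV) (z : V -> 'rV[R]_d) :
  measurable_rV z -> measurable_fun setT (fun t => f (z t)).
Proof.
move=> mz; exact: (measurableT_comp (f := f : borel_rV R d -> R) (continuous_borel_rV cf) mz).
Qed.

(** Smoothness bounds the gap by [L / 2] times the squared distance to [xs]. *)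
Lemma integrable_gap (z : T -> 'rV[R]_d) : sq_integrable P z ->
  P.-integrable setT (EFin \o (fun t => f (z t) - f xs)).
Proof.
move=> sz; have [mz iz] := sq_integrableB sz (sq_integrable_cst P xs).
apply: le_integrable (integrableZ_EFin (L / 2) iz) => //.
  by apply/measurable_EFinP/measurable_funB => //; apply: measurable_objective; case: sz.
move=> t _ /=; rewrite lee_fin ger0_norm ?subr_ge0 ?(minimizer_le xs_min)//.
apply: le_trans (quadratic_upper mu_gt0 mu_leL fS xs_min (z t)) (ler_norm _).
Qed.

Lemma sq_integrable_gradient (z : T -> 'rV[R]_d) :
  sq_integrable P z -> sq_integrable P (fun t => gradient f (z t)).
Proof.
move=> sz; apply: sq_integrable_le (integrableZ_EFin (2 * L) (integrable_gap sz)) _.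
  by apply: measurable_rV_comp => //; case: sz.
by move=> t; exact: (sqr_gradient_le mu_gt0 mu_leL fS xs_min).
Qed.

Section query.
Variables (z : T -> 'rV[R]_d) (w : T -> W).
Hypotheses (sz : sq_integrable P z) (mw : measurable_fun setT w)
  (zw : oracle_query P f g sigma z w).

Let err t := g (z t) (w t) - gradient f (z t).

Let mz : measurable_rV z. Proof. by case: sz. Qed.

Lemma oracle_error_sq_le : (\int[P]_t (dotv (err t) (err t))%:E <= (sigma ^+ 2)%:E)%E.
Proof.
have [_ [V [[iX iV _ XV] Vs]]] := zw.
under eq_integral do rewrite -sqr_enorm.
rewrite XV; last by exists setT => //; rewrite setTI.
rewrite -[leRHS]mule1 -(probability_setT P) -integral_cst//.
(* The bound on [V] holds almost everywhere and [V] may be negative on a null set; its positive part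
   is nonnegative everywhere and obeys the same bound. *)
have iVp := integrable_funepos measurableT iV.
apply: (@le_trans _ _ (\int[P]_t ((EFin \o V)^\+ t)))%E.
  by apply: le_integral => // t _; rewrite funeposE le_max lexx.
apply: ae_ge0_le_integral => //.
- by case/integrableP: iVp.
- by move=> t _; rewrite lee_fin sqr_ge0.
- by apply: filterS Vs => t Vt _; rewrite funeposE ge_max !lee_fin Vt sqr_ge0.
Qed.

Lemma sq_integrable_oracle_error : sq_integrable P err.
Proof.
have [_ [V [[iX _ _ _] _]]] := zw.
split.
  apply: measurable_rVB; first exact: measurable_oracle.
  exact: measurable_rV_comp.
by move: iX; congr integrable; apply/funext => t /=; rewrite sqr_enorm.
Qed.

(** The oracle is unbiased given [z] only, so independence of [w] from each pair [(z, u_i)] is what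
    handles the extra dependence in [u]; [integral_mean_zero_mul] is applied to each coordinate. *)
Lemma oracle_error_orthogonal (u : T -> 'rV[R]_d) :
  sq_integrable P u ->
  (forall i, independent_of P
    (fun t => (z t : borel_rV R d, u t 0 i)) w) ->
  (\int[P]_t (dotv (err t) (u t))%:E = 0)%E.
Proof.
move=> su zu_w.
have se := sq_integrable_oracle_error.
under eq_integral do rewrite /dotv -sumEFin.
rewrite integral_sum//; last by move=> i; exact: integrable_coordM.
apply: big1 => i _.
have [/(_ i)[ig iG _ gG] _] := zw.
pose h (q : borel_rV R d * W) := g q.1 q.2 0 i - gradient f q.1 0 i.
have errE t : err t 0 i = h (z t, w t) by rewrite /h /err !mxE.
under eq_integral do rewrite mulrC errE.
apply: (@integral_mean_zero_mul _ _ _ _ _ (borel_rV R d) _ W z (fun t => u t 0 i) w h) => //.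
- by apply: measurable_rV_coord; case: su.
- apply: measurable_funB.
    exact: measurableT_comp (measurable_coord i) mg.
  apply: (measurable_rV_coord (X := fun q : borel_rV R d * W => gradient f q.1)).
  by apply: measurable_rV_comp => //; exact: measurable_fst.
- by move: (integrableB measurableT ig iG); congr integrable; apply/funext => t.
- move=> B mB.
  have mzB : measurable (z @^-1` B) by rewrite -[X in measurable X]setTI; exact: mz.
  under eq_integral do rewrite EFinB.
  rewrite integralB_EFin//.
  + rewrite gG ?subee//; last by exists B => //; rewrite setTI.
    by apply: integrable_fin_num => //; exact: integrableS iG.
  + exact: integrableS ig.
  + exact: integrableS iG.
- move: (integrable_coordM i se su); congr integrable; apply/funext => t.
  by rewrite /h /err !mxE mulrC.
Qed.

End query.
End oracle.

(** * The algorithm *)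

(** The value [c / s] is the fixed point of the recursion, and the distance to it contracts by
    [1 - s]. *)
Lemma affine_recursion_le (R : realType) (s c : R) (v : nat -> R) N :
  0 < s <= 1 -> 0 <= c ->
  (forall m, (m < N)%N -> v m.+1 <= (1 - s) * v m + c) ->
  v N <= (1 - s) ^+ N * v 0%N + c / s.
Proof.
move=> /andP[s0 s1] c0; elim: N => [_|N IH vS].
  by rewrite expr0 mul1r lerDl divr_ge0// ltW.
apply: le_trans (vS _ (ltnSn N)) _.
have {}IH := IH (fun m mN => vS m (ltnW mN : (m < N.+1)%N)).
apply: (@le_trans _ _ ((1 - s) * ((1 - s) ^+ N * v 0%N + c / s) + c)).
  by rewrite lerD2r ler_wpM2l// subr_ge0.
rewrite le_eqVlt; apply/orP; left; apply/eqP; rewrite exprS; field.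
by rewrite gt_eqF.
Qed.

Section masg.
Context (dT : measure_display) (T : measurableType dT) (R : realType)
  (P : probability T R) (dW : measure_display) (W : measurableType dW) (d : nat).
Variables (mu L : R) (f : 'rV[R]_d -> R) (xs : 'rV[R]_d) (sigma : R)
  (n : nat -> nat) (alpha : nat -> R) (g : 'rV[R]_d -> W -> 'rV[R]_d)
  (w : nat * nat -> T -> W) (x00 : 'rV[R]_d) (x y : nat -> nat -> T -> 'rV[R]_d).
Hypotheses (mu_gt0 : 0 < mu) (mu_leL : mu <= L) (fS : S_class mu L f)
  (xs_min : unique_minimizer f xs)
  (mg : measurable_fun setT (fun zv : borel_rV R d * W => g zv.1 zv.2 : borel_rV R d))
  (wI : mutually_independent P (query_index n) w)
  (xy : is_masg mu n alpha g w x00 x y)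
  (yw : forall k m, query_index n (k, m) -> oracle_query P f g sigma (y k m) (w (k, m))).

(** The past of query [(k, m)], queries being ordered lexicographically. *)
Definition earlier_queries k m : set (nat * nat) :=
  query_index n `&` [set q | (q.1 < k)%N || (q.1 == k) && (q.2 < m)%N].

(** Induction along the run: iterates arise from [x00] by linear combinations and oracle answers.
    Two consecutive iterates are carried because [y] combines both, and answers are restricted to
    earlier queries in order to track what an iterate depends on. *)
Lemma masg_ind (Q : (T -> 'rV[R]_d) -> Prop) k m :
  (1 <= k)%N -> (m <= n k)%N ->
  Q (fun=> x00) ->
  (forall a b X Y, Q X -> Q Y -> Q (fun t => a *: X t + b *: Y t)) ->
  (forall k' m', earlier_queries k m.+1 (k', m') -> Q (y k' m') ->
    Q (fun t => g (y k' m' t) (w (k', m') t))) ->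
  Q (x k m) /\ Q (x k m.+1).
Proof.
move=> + + Q0 QL; elim: k m => [//|k IHk] m _.
(* A stage starts at [x00] or at the end of the previous stage, whose queries all precede this
   stage. *)
have start m0 : (forall k' m', earlier_queries k.+1 m0.+1 (k', m') -> Q (y k' m') ->
    Q (fun t => g (y k' m' t) (w (k', m') t))) -> Q (x k.+1 1%N).
  case: k IHk => [_ _|k IHk QW].
    by rewrite (_ : x 1%N 1%N = fun=> x00)//; apply/funext => t; exact: (masg_init xy).
  rewrite (_ : x k.+2 1%N = x k.+1 (n k.+1).+1); last first.
    by apply/funext => t; exact: (masg_restart xy).
  apply: (IHk (n k.+1) _ _ _).2 => // k' m' [q km]; apply: QW; split=> //.
  by apply/orP; left; case/orP: km => /= [|/andP[/eqP->]] //; exact: ltnW.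
elim: m => [_ QW|m IHm mn QW].
  split; last exact: start QW.
  rewrite (_ : x k.+1 0%N = x k.+1 1%N); first exact: start QW.
  by apply/funext => t; exact: (masg_no_momentum xy).
have [Qx Qx1] : Q (x k.+1 m) /\ Q (x k.+1 m.+1).
  apply: IHm; first exact: ltnW.
  move=> k' m' [q km]; apply: QW; split=> //; apply/orP.
  by case/orP: km => /= [->|/andP[-> /leqW->]]; [left|right].
split=> //.
have qm : query_index n (k.+1, m.+1) by split=> //=; exact: mn.
have Qy : Q (y k.+1 m.+1).
  rewrite (_ : y _ _ = fun t => (1 + momentum mu (alpha k.+1)) *: x k.+1 m.+1 t
              + - momentum mu (alpha k.+1) *: x k.+1 m t); first exact: QL.
  by apply/funext => t; rewrite (masg_query xy t qm) scaleNr.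
rewrite (_ : x _ _ = fun t => 1 *: y k.+1 m.+1 t +
  - alpha k.+1 *: g (y k.+1 m.+1 t) (w (k.+1, m.+1) t)).
  apply: QL => //; apply: QW => //; split=> //=.
  by rewrite eqxx ltnSn orbT.
by apply/funext => t; rewrite (masg_update xy t qm) scale1r scaleNr.
Qed.

Lemma masg_measurable dV (V : measurableType dV) (phi : V -> T) k m :
  (1 <= k)%N -> (m <= n k)%N ->
  (forall q, earlier_queries k m.+1 q -> measurable_fun setT (w q \o phi)) ->
  measurable_rV (x k m \o phi) /\ measurable_rV (x k m.+1 \o phi).
Proof.
move=> k1 mn mw; apply: (masg_ind (Q := fun X => measurable_rV (X \o phi))) => //.
- exact: measurable_rV_cst.
- by move=> a b X Y mX mY; apply: measurable_rVD; exact: measurable_rVZ.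
- move=> k' m' km mY; apply: (measurable_oracle mg mY); exact: mw km.
Qed.

Lemma masg_y_comb k m : query_index n (k, m) ->
  y k m = fun t => (1 + momentum mu (alpha k)) *: x k m t
                   - momentum mu (alpha k) *: x k m.-1 t.
Proof. by move=> km; apply/funext => t; exact: (masg_query xy). Qed.

Lemma masg_sq_integrable k m : (1 <= k)%N -> (m <= n k)%N ->
  sq_integrable P (x k m) /\ sq_integrable P (x k m.+1).
Proof.
move=> k1 mn; apply: masg_ind => //.
- exact: sq_integrable_cst.
- by move=> a b X Y sX sY; apply: sq_integrableD; exact: sq_integrableZ.
- move=> k' m' [km _] sY.
  (* The oracle answer is split into error plus gradient. *)
  have se := sq_integrable_oracle_error fS mg sY (wI.1 _ km) (yw km).
  have sG := sq_integrable_gradient mu_gt0 mu_leL fS xs_min sY.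
  by move: (sq_integrableD se sG); congr sq_integrable; apply/funext => t; rewrite subrK.
Qed.

(** The last two iterates are determined by the past, of which [w (k, m)] is independent.
    Measurability of [F] is asked over every space [V] so that it applies to [T] with the
    sigma-algebra of the past. *)
Lemma masg_independent (dZ : measure_display) (Z : measurableType dZ)
    (F : 'rV[R]_d -> 'rV[R]_d -> Z) k m :
  query_index n (k, m) ->
  (forall dV (V : measurableType dV) (X Y : V -> 'rV[R]_d), measurable_rV X ->
     measurable_rV Y -> measurable_fun setT (fun v => F (X v) (Y v))) ->
  independent_of P (fun t => F (x k m t) (x k m.-1 t)) (w (k, m)).
Proof.
move=> km mF A B mA mB.
have [/= k1 /andP[m1 mn]] := km.
pose K := earlier_queries k m.
apply: (past_independent wI (K := K)) => //.
- by move=> q [].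
- by move=> [_ /=]; rewrite ltnn eqxx ltnn.
pose phi : g_sigma_algebraType (cylinder w K) -> T := id.
have mw q : earlier_queries k m.-1.+1 q -> measurable_fun setT (w q \o phi).
  rewrite prednK// => Kq _ C mC; rewrite setTI; apply: sub_sigma_algebra.
  exists [fset q]%fset, (fun=> C); split=> //.
  - by move=> i /=; rewrite in_fset1 => /eqP ->.
  - apply/seteqP; split=> [t Ct i /=|t /(_ q)]; first by rewrite in_fset1 => /eqP ->.
    by apply; rewrite /= in_fset1.
have [mx' mx] := masg_measurable k1 (leq_trans (leq_pred m) mn) mw.
rewrite prednK// in mx.
have := mF _ _ _ _ mx mx' measurableT _ mA; rewrite setTI; exact.
Qed.


(** * Expected decrease within one stage *)

Section stage.
Variable k : nat.
Hypotheses (k1 : (1 <= k)%N) (a_gt0 : 0 < alpha k) (aL : alpha k * L <= 1).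

Let a := alpha k.
Let s := Num.sqrt (mu * a).
Let L_gt0 : 0 < L. Proof. exact: lt_le_trans mu_leL. Qed.
(** The index is shifted: [V 0] involves [x k 1] and [x k 0], which coincide. *)
Let V m t := lyapunov mu f xs a (x k m.+1 t) (x k m t).

Lemma integrable_lyapunov X Y : sq_integrable P X -> sq_integrable P Y ->
  P.-integrable setT (EFin \o (fun t => lyapunov mu f xs a (X t) (Y t))).
Proof.
move=> sX sY.
have sx Z : sq_integrable P Z -> sq_integrable P (fun t => Z t - xs).
  by move=> sZ; exact/sq_integrableB/sq_integrable_cst.
have [_ iz] := sq_integrableB (sx _ sX) (sq_integrableZ (1 - s) (sx _ sY)).
have := integrableD_EFin (integrableZ_EFin (2 * a)^-1 iz)
  (integrable_gap mu_gt0 mu_leL fS xs_min sX).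
by congr integrable; apply/funext => t /=; rewrite mulrC.
Qed.

Lemma expected_lyapunov_step m : (m < n k)%N ->
  \int[P]_t V m.+1 t <=
    (1 - s) * (\int[P]_t V m t) + a * (1 + a * L) / 2 * sigma ^+ 2.
Proof.
move=> mn.
have km : query_index n (k, m.+1) by split.
have [sx0 sx1] := masg_sq_integrable k1 (ltnW mn).
have [_ sx2] := masg_sq_integrable k1 mn.
pose z t := (1 + momentum mu a) *: x k m.+1 t - momentum mu a *: x k m t.
have yE : y k m.+1 = z by rewrite (masg_y_comb km).
have sz : sq_integrable P z by apply: sq_integrableB; exact: sq_integrableZ.
have zw := yw km; rewrite yE in zw.
have mw := wI.1 _ km.
pose e t := g (z t) (w (k, m.+1) t) - gradient f (z t).
have se : sq_integrable P e := sq_integrable_oracle_error fS mg sz mw zw.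
have ie := integrable_dotv se se.
(* The vector paired with the noise in [lyapunov_step], as a function of the query point [p] and the
   current iterate [q]. *)
pose Uf (p q : 'rV[R]_d) : 'rV[R]_d :=
  L * a ^+ 2 *: gradient f p - s *: (p - xs) - (1 - s) *: (p - q).
pose U t := Uf (z t) (x k m.+1 t).
have sU : sq_integrable P U.
  apply: sq_integrableB; last exact/sq_integrableZ/sq_integrableB.
  apply: sq_integrableB; apply: sq_integrableZ.
    exact: (sq_integrable_gradient mu_gt0 mu_leL fS xs_min sz).
  exact/sq_integrableB/sq_integrable_cst.
have ieU := integrable_dotv se sU.
have eU : \int[P]_t dotv (e t) (U t) = 0.
  rewrite /Rintegral (oracle_error_orthogonal fS mg sz mw zw sU)// => i.
  pose zf (p q : 'rV[R]_d) := (1 + momentum mu a) *: p - momentum mu a *: q.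
  apply: (masg_independent (Z := (borel_rV R d * R)%type)
    (F := fun p q => (zf p q, Uf (zf p q) p 0 i)) km) => dV S X Y mX mY.
  have mz : measurable_rV (fun v => zf (X v) (Y v)).
    by apply: measurable_rVB; exact: measurable_rVZ.
  apply: measurable_fun_pair => //; apply: measurable_rV_coord.
  apply: measurable_rVB; last exact/measurable_rVZ/measurable_rVB.
  apply: measurable_rVB; apply: measurable_rVZ.
    by apply: measurable_rV_comp mz; case: fS => -[].
  exact/measurable_rVB/measurable_rV_cst.
have ee : \int[P]_t dotv (e t) (e t) <= sigma ^+ 2.
  rewrite -lee_fin /Rintegral fineK; last exact: integrable_fin_num.
  exact: oracle_error_sq_le zw.
have iV0 := integrable_lyapunov sx1 sx0.
have c_ge0 : 0 <= a * (1 + a * L) / 2.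
  by rewrite divr_ge0// mulr_ge0 ?addr_ge0 ?mulr_ge0// ltW.
apply: (@le_trans _ _ (\int[P]_t ((1 - s) * V m t
    + a * (1 + a * L) / 2 * dotv (e t) (e t) + dotv (e t) (U t)))).
  apply: le_Rintegral => //.
  - exact: integrable_lyapunov.
  - apply: integrableD_EFin => //.
    by apply: integrableD_EFin; exact: integrableZ_EFin.
  - move=> t _; rewrite /V /U /Uf (masg_update xy t km) yE.
    have -> : g (z t) (w (k, m.+1) t) = gradient f (z t) + e t by rewrite addrC subrK.
    exact: (lyapunov_step mu_gt0 mu_leL fS xs (e t) a_gt0 aL (erefl (z t))).
rewrite RintegralD ?eU ?addr0//; last first.
  by apply: integrableD_EFin; exact: integrableZ_EFin.
rewrite RintegralD//; [|exact: integrableZ_EFin..].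
by rewrite !RintegralZl// lerD2l ler_wpM2l.
Qed.

Lemma stage_bound :
  \int[P]_t (f (x k (n k).+1 t) - f xs) <=
    2 * (1 - s) ^+ n k * (\int[P]_t (f (x k 1%N t) - f xs))
    + sigma ^+ 2 * a * (1 + a * L) / (2 * s).
Proof.
have [sxn sxn1] := masg_sq_integrable k1 (leqnn (n k)).
have [sx0 sx1] := masg_sq_integrable k1 (leq0n (n k)).
have gap_int := integrable_gap mu_gt0 mu_leL fS xs_min.
have s_gt0 : 0 < s by rewrite sqrtr_gt0 mulr_gt0.
have s_le1 : s <= 1.
  have s2 : s ^+ 2 = mu * a by rewrite sqr_sqrtr// mulr_ge0 ?ltW.
  rewrite -(@ler_sqr _ s 1) ?nnegrE ?sqrtr_ge0// s2 expr1n (le_trans _ aL)//.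
  by rewrite mulrC ler_pM2l.
apply: (@le_trans _ _ (\int[P]_t V (n k) t)).
  apply: le_Rintegral => //; [exact: gap_int|exact: integrable_lyapunov|].
  by move=> t _; exact: lyapunov_ge.
have c_ge0 : 0 <= a * (1 + a * L) / 2 * sigma ^+ 2.
  by rewrite mulr_ge0 ?sqr_ge0// divr_ge0// mulr_ge0 ?addr_ge0 ?mulr_ge0// ltW.
have s01 : 0 < s <= 1 by rewrite s_gt0.
apply: le_trans (affine_recursion_le s01 c_ge0 expected_lyapunov_step) _.
apply: lerD; last first.
  rewrite le_eqVlt; apply/orP; left; apply/eqP; field.
  by rewrite gt_eqF.
rewrite -mulrA mulrCA ler_wpM2l ?exprn_ge0 ?subr_ge0//.
rewrite -RintegralZl//; last exact: gap_int.
apply: le_Rintegral => //.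
- exact: integrable_lyapunov.
- exact/integrableZ_EFin/gap_int.
(* The stage starts without momentum, hence the factor 2 from [lyapunov_diag_le]. *)
- move=> t _; rewrite /V (masg_no_momentum xy)//.
  exact: (lyapunov_diag_le mu_gt0 mu_leL fS xs_min).
Qed.

End stage.

End masg.

(** * Expected decrease over the stages *)

(** This is the rate [s] of a stage; [q] will be 1 in the first stage and [2 ^+ k] in stage k. *)
Lemma sqrt_stepsize (R : realType) (mu L q : R) : 0 < mu -> 0 < L -> 0 < q ->
  Num.sqrt (mu * (1 / (q ^+ 2 * L))) = (q * Num.sqrt (L / mu))^-1.
Proof.
move=> mu0 L0 q0.
have k0 : 0 < L / mu by rewrite divr_gt0.
have -> : mu * (1 / (q ^+ 2 * L)) = (q * Num.sqrt (L / mu))^-1 ^+ 2.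
  rewrite exprVn exprMn sqr_sqrtr ?ltW//; field.
  by rewrite !gt_eqF.
by rewrite sqrtr_sqr ger0_norm// invr_ge0 mulr_ge0 ?sqrtr_ge0 ?ltW.
Qed.

Lemma expr1B_le_expR (R : realType) (s : R) m :
  s <= 1 -> (1 - s) ^+ m <= expR (- (m%:R * s)).
Proof.
move=> s1; rewrite -mulrN mulrC expRM_natr lerXn2r ?nnegrE ?subr_ge0 ?expR_ge0//.
exact: expR_ge1Dx.
Qed.

(** The factor [2 ^ k] of the stage length cancels the one in the rate, leaving at most 2^-(p+2);
    the leading 2 costs one power. *)
Lemma contraction_factor (R : realType) (p r : R) k : 0 < r -> 0 <= p ->
  2 * expR (- ((2 ^ k * `|Num.ceil (r * ln (2 `^ (p + 2)))|)%N%:R * (2 ^+ k * r)^-1))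
    <= (2 `^ (p + 1))^-1.
Proof.
move=> r0 p0; set l := ln _; set N := `|_|%N.
have E2 : 2 `^ (p + 2) = 2 * 2 `^ (p + 1).
  rewrite (_ : p + 2 = 1 + (p + 1)); last by ring.
  by rewrite [LHS]powRD ?powRr1// pnatr_eq0 implybT.
have l0 : 0 <= l.
  rewrite ln_ge0// -[leLHS](powRr0 2).
  by apply: ler_powR; rewrite ?ler1n// addr_ge0.
have rN : r * l <= N%:R.
  apply: le_trans (ceil_ge _) _.
  by rewrite -[leRHS]/((N%:Z)%:~R) ler_int lez_abs.
have -> : (2 ^ k * N)%N%:R * (2 ^+ k * r)^-1 = N%:R / r.
  rewrite natrM natrX; field.
  by rewrite (gt_eqF r0) expf_neq0// pnatr_eq0.
have : expR (- (N%:R / r)) <= (2 `^ (p + 2))^-1.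
  rewrite -[X in _ <= X^-1]lnK ?posrE ?powR_gt0// -/l -expRN ler_expR lerN2.
  by rewrite ler_pdivlMr// mulrC.
move=> h; apply: (@le_trans _ _ (2 * (2 `^ (p + 2))^-1)); first by rewrite ler_pM2l.
by rewrite E2 invfM mulrA divff ?mul1r// pnatr_eq0.
Qed.

Section masg_stage.
Context (dT : measure_display) (T : measurableType dT) (R : realType)
  (P : probability T R) (dW : measure_display) (W : measurableType dW) (d : nat).
Variables (mu L : R) (f : 'rV[R]_d -> R) (xs : 'rV[R]_d) (sigma : R)
  (n : nat -> nat) (alpha : nat -> R) (g : 'rV[R]_d -> W -> 'rV[R]_d)
  (w : nat * nat -> T -> W) (x00 : 'rV[R]_d) (x y : nat -> nat -> T -> 'rV[R]_d).
Hypotheses (mu_gt0 : 0 < mu) (mu_leL : mu <= L) (fS : S_class mu L f)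
  (xs_min : unique_minimizer f xs)
  (mg : measurable_fun setT (fun zv : borel_rV R d * W => g zv.1 zv.2 : borel_rV R d))
  (wI : mutually_independent P (query_index n) w)
  (xy : is_masg mu n alpha g w x00 x y)
  (yw : forall k m, query_index n (k, m) -> oracle_query P f g sigma (y k m) (w (k, m))).

Lemma stage_bound_scaled k q (r := Num.sqrt (L / mu)) :
  (1 <= k)%N -> 1 <= q -> alpha k = 1 / (q ^+ 2 * L) ->
  \int[P]_t (f (x k (n k).+1 t) - f xs) <=
    2 * expR (- ((n k)%:R * (q * r)^-1)) * (\int[P]_t (f (x k 1%N t) - f xs))
    + sigma ^+ 2 * r / (L * q).
Proof.
move=> k1 q1 ak.
have L_gt0 : 0 < L by exact: lt_le_trans mu_leL.
have q_gt0 : 0 < q by exact: lt_le_trans q1.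
have r_gt0 : 0 < r by rewrite sqrtr_gt0 divr_gt0.
have r_ge1 : 1 <= r.
  by rewrite -[leLHS]sqrtr1 ler_wsqrtr// ler_pdivlMr// mul1r.
have qr_gt0 : 0 < q * r by rewrite mulr_gt0.
have a_gt0 : 0 < alpha k by rewrite ak mul1r invr_gt0 mulr_gt0 ?exprn_gt0.
have q2 : q ^- 2 <= 1 by rewrite invf_le1 ?exprn_gt0// exprn_ege1.
have aLE : alpha k * L = q ^- 2.
  by rewrite ak; field; rewrite !gt_eqF.
have aL : alpha k * L <= 1 by rewrite aLE.
apply: le_trans (stage_bound mu_gt0 mu_leL fS xs_min mg wI xy yw k1 a_gt0 aL) _.
rewrite aLE ak sqrt_stepsize// -/r.
have gap_ge0 : 0 <= \int[P]_t (f (x k 1%N t) - f xs).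
  by apply: Rintegral_ge0 => t _; rewrite subr_ge0 minimizer_le.
apply: lerD.
  rewrite ler_wpM2r// ler_pM2l// expr1B_le_expR// invf_le1//.
  by rewrite -[leLHS]mul1r ler_pM// ltW.
(* The noise term is the target times the mean of 1 and [q ^- 2], and that mean is at most 1. *)
have -> : sigma ^+ 2 * (1 / (q ^+ 2 * L)) * (1 + q ^- 2) / (2 * (q * r)^-1) =
    sigma ^+ 2 * r / (L * q) * ((1 + q ^- 2) / 2).
  by field; rewrite !gt_eqF.
rewrite ler_piMr//; last by lra.
by apply: divr_ge0; apply: mulr_ge0; rewrite ?sqr_ge0 ?ltW.
Qed.

(** Integrability makes the extended-real expectation finite, so that the later estimates can be
    made in [R]. *)
Lemma expectation_gap k m : (1 <= k)%N -> (m <= n k)%N ->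
  ('E_P[fun t => f (x k m.+1 t)] - (f xs)%:E =
   (\int[P]_t (f (x k m.+1 t) - f xs))%:E)%E.
Proof.
move=> k1 mn.
have [_ sx] := masg_sq_integrable mu_gt0 mu_leL fS xs_min mg wI xy yw k1 mn.
have ig := integrable_gap mu_gt0 mu_leL fS xs_min sx.
have ic : P.-integrable setT (EFin \o (fun=> f xs)).
  exact: finite_measure_integrable_cst.
rewrite unlock /Rintegral fineK; last exact: integrable_fin_num.
have -> : (\int[P]_t (f (x k m.+1 t))%:E =
    \int[P]_t ((f (x k m.+1 t) - f xs)%:E + (f xs)%:E))%E.
  by apply: eq_integral => t _; rewrite -EFinD subrK.
rewrite integralD//= integral_cst//= (probability_setT P) mule1.
by rewrite addeK.
Qed.

End masg_stage.

(** * Induction over the stages *)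

Theorem theorem3p4
  (R : realType) (d : nat)
  (dT : measure_display) (T : measurableType dT) (P : probability T R)
  (dW : measure_display) (W : measurableType dW)
  (mu L : R) (hmu : 0 < mu) (hmuL : mu <= L) (kappa := L / mu)
  (f : 'rV[R]_d -> R) (hf : S_class mu L f)
  (xs : 'rV[R]_d) (hxs : unique_minimizer f xs)
  (sigma : R) (hsigma : 0 <= sigma)
  (p : R) (hp : 1 <= p) (n1 : nat) (hn1 : (1 <= n1)%N)
  (n : nat -> nat) (alpha : nat -> R)
  (hn_1 : n 1%N = n1)
  (hn_k : forall k, (2 <= k)%N ->
     n k = (2 ^ k * `|Num.ceil (Num.sqrt kappa * ln (2 `^ (p + 2)))|)%N)
  (halpha_1 : alpha 1%N = 1 / L)
  (halpha_k : forall k, (2 <= k)%N -> alpha k = 1 / (2 ^+ (2 * k) * L))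
  (g : 'rV[R]_d -> W -> 'rV[R]_d)
  (hg : measurable_fun setT
     (fun zv : borel_rV R d * W => g zv.1 zv.2 : borel_rV R d))
  (w : nat * nat -> T -> W)
  (hw : mutually_independent P (query_index n) w)
  (x00 : 'rV[R]_d) (x y : nat -> nat -> T -> 'rV[R]_d)
  (hmasg : is_masg mu n alpha g w x00 x y)
  (horacle : forall k m, query_index n (k, m) ->
     oracle_query P f g sigma (y k m) (w (k, m))) :
  forall k, (1 <= k)%N ->
    ('E_P[fun t => f (x k (n k).+1 t)] - (f xs)%:E <=
      (2 / 2 `^ ((p + 1) * (k - 1)%:R)
         * expR (- (n1%:R / Num.sqrt kappa)) * (f x00 - f xs)
       + sigma ^+ 2 * Num.sqrt kappa / (L * 2 ^+ (k - 1)))%:E)%E.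
Proof.
move=> [//|j] _.
rewrite (expectation_gap hmu hmuL hf hxs hg hw hmasg horacle)// lee_fin subn1 /=.
have L_gt0 : 0 < L by exact: lt_le_trans hmuL.
have r_gt0 : 0 < Num.sqrt kappa by rewrite sqrtr_gt0 divr_gt0.
have stage := stage_bound_scaled hmu hmuL hf hxs hg hw hmasg horacle.
elim: j => [|j IH].
  have a1 : alpha 1%N = 1 / (1 ^+ 2 * L) by rewrite halpha_1 expr1n !mul1r.
  apply: le_trans (stage _ _ _ (lexx 1) a1) _ => //.
  rewrite hn_1 mul1r mulr0 powRr0 divr1 -/kappa.
  (* The first stage starts at a deterministic point. *)
  rewrite (_ : \int[P]_t _ = f x00 - f xs) ?expr0//.
  under eq_Rintegral do rewrite (masg_init hmasg).
  rewrite Rintegral_cst// -[RHS]mulr1; congr (_ * _).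
  exact: (congr1 fine (probability_setT P)).
set B := (X in _ <= X) in IH.
have aj : alpha j.+2 = 1 / ((2 ^+ j.+2) ^+ 2 * L).
  by rewrite halpha_k// mulnC exprM.
have q1 : 1 <= 2 ^+ j.+2 :> R by rewrite exprn_ege1// ler1n.
apply: le_trans (stage _ _ _ q1 aj) _ => //.
rewrite hn_k// -/kappa.
have gapE : \int[P]_t (f (x j.+2 1%N t) - f xs) = \int[P]_t (f (x j.+1 (n j.+1).+1 t) - f xs).
  by apply: eq_Rintegral => t _; rewrite (masg_restart hmasg).
have gap_ge0 : 0 <= \int[P]_t (f (x j.+2 1%N t) - f xs).
  by apply: Rintegral_ge0 => t _; rewrite subr_ge0 minimizer_le.
have p0 : 0 <= p by exact: le_trans hp.
(* The stage starts where the previous one ended, so its initial gap is at most the inductive bound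
   [B]. *)
apply: (@le_trans _ _ ((2 `^ (p + 1))^-1 * B
    + sigma ^+ 2 * Num.sqrt kappa / (L * 2 ^+ j.+2))).
  rewrite lerD2r; apply: ler_pM => //.
    exact: contraction_factor.
  by rewrite gapE.
have w0 : 0 < 2 `^ (p + 1) by rewrite powR_gt0.
(* Here [1 <= p] enters. *)
have w4 : (2 `^ (p + 1))^-1 <= 4^-1.
  rewrite lef_pV2 ?posrE//.
  have -> : 4 = 2 `^ 2%:R :> R by rewrite powR_mulrn// expr2 -natrM.
  by apply: ler_powR; [rewrite ler1n|lra].
rewrite /B mulrDr -addrA; apply: lerD.
  have -> : 2 `^ ((p + 1) * j.+1%:R) = 2 `^ ((p + 1) * j%:R) * 2 `^ (p + 1).
    by rewrite -(natr1 j) mulrDr mulr1 [LHS]powRD// pnatr_eq0 implybT.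
  rewrite le_eqVlt; apply/orP; left; apply/eqP; field.
  by rewrite !gt_eqF ?powR_gt0.
set C := sigma ^+ 2 * Num.sqrt kappa / (L * 2 ^+ j).
(* With [C] the noise part of the previous bound, at most [C / 4] is inherited and [C / 4] is added,
   which gives the target [C / 2]. *)
have C0 : 0 <= C.
  by rewrite divr_ge0// mulr_ge0 ?sqr_ge0 ?exprn_ge0// ltW.
have -> : sigma ^+ 2 * Num.sqrt kappa / (L * 2 ^+ j.+2) = C / 4.
  by rewrite /C !exprS; field; rewrite ?expf_neq0 ?pnatr_eq0 ?gt_eqF.
have -> : sigma ^+ 2 * Num.sqrt kappa / (L * 2 ^+ j.+1) = C / 2.
  by rewrite /C !exprS; field; rewrite ?expf_neq0 ?pnatr_eq0 ?gt_eqF.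
have := ler_wpM2r C0 w4; lra.
Qed.
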